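(* AMLFI1 is compact: for every $\Gamma\cup\{\alpha\}\subseteq\mathcal{L}_{AM}$, if $\Gamma\vDash_{AMLFI1}\alpha$, then there exists a finite $\Gamma'\subseteq\Gamma$ such that $\Gamma'\vDash_{AMLFI1}\alpha$.
   Context: **Language.** $P$ is a countable set of propositional variables and $N$ a finite set of agents. The formulas of $\mathcal{L}_{AM}$ and the action models are defined by simultaneous recursion. Formulas: $\alpha ::= p \mid \neg\alpha \mid \bullet\alpha \mid (\alpha\land\alpha) \mid K_i\alpha \mid [U,e]\alpha$, with $p\in P$, $i\in N$, $U$ an action model and $e$ an action of $U$. An action model is $U=\langle E,\{\sim_i\}_{i\in N},\mathrm{pre}\rangle$ with $E$ a finite non-empty set of actions, each $\sim_i$ an equivalence relation on $E$, and $\mathrm{pre}:E\to\mathcal{L}_{AM}$ (preconditions). **Semantics.** Truth values $\{0,\tfrac12,1\}$, designated values $D=\{1,\tfrac12\}$. A Kripke model is $M=\langle S,\{\sim_i\}_{i\in N},\vartheta\rangle$ with $S$ a set of states, each $\sim_i$ an equivalence relation on $S$, and for each $s\in S$ a map $\vartheta_s:P\to\{0,\tfrac12,1\}$, extended to formulas by: $\vartheta_s(\neg\alpha)=1-\vartheta_s(\alpha)$; $\vartheta_s(\bullet\alpha)=1$ if $\vartheta_s(\alpha)=\tfrac12$ and $0$ otherwise; $\vartheta_s(\alpha\land\beta)=\min\{\vartheta_s(\alpha),\vartheta_s(\beta)\}$; $\vartheta_s(K_i\alpha)=\inf\{\vartheta_{t}(\alpha):s\sim_i t\}$ (with $\inf\emptyset=1$);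 $\vartheta_s([U,e]\alpha)=\vartheta'_{(s,e)}(\alpha)$ if $\vartheta_s(\mathrm{pre}(e))\in D$, and $1$ otherwise. Here $\vartheta'$ is the valuation of the updated model $M\otimes U=\langle S',\{\sim_i'\},\vartheta'\rangle$ with $S'=\{(t,f):t\in S,f\in E,\vartheta_t(\mathrm{pre}(f))\in D\}$, $(t,f)\sim'_i(u,g)$ iff $t\sim_i u$ and $f\sim_i g$, and $\vartheta'_{(t,f)}(p)=\vartheta_t(p)$ for $p\in P$. $\Gamma\vDash_{AMLFI1}\alpha$ means: for every such model and every state $s$, if $\vartheta_s(\gamma)\in D$ for all $\gamma\in\Gamma$ then $\vartheta_s(\alpha)\in D$. *)

(* Defs.v *)
From HB Require Import structures.
From Stdlib Require Import RelationClasses.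
From Stdlib Require List.
From mathcomp Require Import all_boot.
From mathcomp Require Import boolp classical_sets.

Set Implicit Arguments.
Unset Strict Implicit.
Unset Printing Implicit Defensive.

Local Open Scope classical_set_scope.

Inductive tv := Zero | Half | One.

(* The order on {0, 1/2, 1} is read off the doubled values 0, 1, 2. *)
Definition twice (x : tv) : nat :=
  match x with Zero => 0 | Half => 1 | One => 2 end.

Definition tle (x y : tv) : bool := twice x <= twice y.

Definition designated (x : tv) : bool := tle Half x.

Definition tneg (x : tv) : tv :=
  match x with Zero => One | Half => Half | One => Zero end.

Definition tincons (x : tv) : tv := if x is Half then One else Zero.

Definition tmin (x y : tv) : tv := if tle x y then x else y.

(* Greatest lower bound (see tinf_lb and tinf_glb); the empty set gives One. *)
Definition tinf (A : set tv) : tv :=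
  if `[< A Zero >] then Zero else if `[< A Half >] then Half else One.

Lemma tinf_lb (A : set tv) x : A x -> tle (tinf A) x.
Proof.
by rewrite /tinf => Ax; do 2?case: asboolP => //; case: x Ax.
Qed.

Lemma tinf_glb (A : set tv) x : (forall y, A y -> tle x y) -> tle x (tinf A).
Proof.
by rewrite /tinf => lbx; do 2?case: asboolP => [/lbx//|_]; case: x {lbx}.
Qed.

(* An action model over the carrier E with preconditions in F.  The language F
   is a parameter because formulas and action models are defined together; E is
   a parameter because the constructor Act below must name an action of U. *)
Record action_model (N : Type) (E : finType) (F : Type) := ActionModel {
  action_nonempty : 0 < #|E|;
  indist : N -> rel E;
  indist_equiv : forall i, equivalence_rel (indist i);
  pre : E -> F
}.

(* Incons a is the inconsistency formula (bullet a), Know i a is K_i a, and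
   Act U e a is [U,e]a. *)
Inductive formula (P N : Type) : Type :=
  | Var (p : P)
  | Neg (a : formula P N)
  | Incons (a : formula P N)
  | And (a b : formula P N)
  | Know (i : N) (a : formula P N)
  | Act (E : finType) (U : action_model N E (formula P N)) (e : E)
        (a : formula P N).

Record kripke (P N : Type) := Kripke {
  state :> Type;
  acc : N -> state -> state -> Prop;
  acc_equiv : forall i, Equivalence (acc i);
  val_at : state -> P -> tv
}.

Section Semantics.
Variables (P N : Type).

Section Update.
Variables (M : kripke P N) (E : finType) (F : Type) (U : action_model N E F).
Variable exec : pred (M * E).

Definition update_acc (i : N) (x y : {te : M * E | exec te}) : Prop :=
  acc i (val x).1 (val y).1 /\ indist U i (val x).2 (val y).2.

Lemma update_acc_equiv i : Equivalence (update_acc i).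
Proof.
have iE := indist_equiv U i; have [r s t] := acc_equiv M i.
split=> [x|x y [xy1 xy2]|x y z [xy1 xy2] [yz1 yz2]]; split.
- exact: r.
- by have [] := iE (val x).2 (val x).2 (val x).2.
- exact: s.
- have [_ h] := iE (val x).2 (val y).2 (val x).2.
  by rewrite -(h xy2); have [] := iE (val x).2 (val x).2 (val x).2.
- exact: t xy1 yz1.
- have [_ h] := iE (val x).2 (val y).2 (val z).2.
  by rewrite (h xy2).
Qed.

(* The product of M and U, where exec (t, f) says that f is executable at t,
   i.e. that the precondition of f is designated at t. *)
Definition update : kripke P N :=
  Kripke update_acc_equiv (fun x : {te : M * E | exec te} => val_at (val x).1).

End Update.

(* [insub (s, e)] is the state (s, e) of the updated model when it exists, and
   None when the precondition of e is not designated at s. *)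
Fixpoint eval (a : formula P N) (M : kripke P N) (s : M) {struct a} : tv :=
  match a with
  | Var p => val_at s p
  | Neg b => tneg (eval b s)
  | Incons b => tincons (eval b s)
  | And b c => tmin (eval b s) (eval c s)
  | Know i b => tinf [set eval b t | t in [set t | acc i s t]]
  | Act E U e b =>
      let exec (x : M * E) := designated (eval (pre U x.2) x.1) in
      if (insub (s, e) : option {x : M * E | exec x}) is Some s'
      then @eval b (update U exec) s'
      else One
  end.

Definition executable (M : kripke P N) (E : finType)
    (U : action_model N E (formula P N)) : pred (M * E) :=
  fun x => designated (eval (pre U x.2) x.1).

Lemma eval_Act_pre (M : kripke P N) (s : M) (E : finType)
    (U : action_model N E (formula P N)) (e : E) (a : formula P N)
    (h : executable U (s, e)) :
  eval (Act U e a) s =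
  @eval a (update U (@executable M E U)) (exist _ (s, e) h).
Proof. by rewrite /= (insubT (@executable M E U) h). Qed.

Lemma eval_Act_npre (M : kripke P N) (s : M) (E : finType)
    (U : action_model N E (formula P N)) (e : E) (a : formula P N) :
  ~~ designated (eval (pre U e) s) -> eval (Act U e a) s = One.
Proof. by move=> h; rewrite /= insubN. Qed.

(* Sets of formulas are plain predicates: formula quantifies over finType, so it
   does not fit in the universe of the argument of [set]. *)
Definition entails (G : formula P N -> Prop) (a : formula P N) : Prop :=
  forall (M : kripke P N) (s : M),
    (forall g, G g -> designated (eval g s)) -> designated (eval a s).

End Semantics.

(* Main.v *)
(** Action modalities can be eliminated: [U,e]b is equivalent to a static formula
    obtained by pushing the action through the connectives and through K_i, where
    it becomes a finite conjunction over the actions that i confuses with e.  It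
    remains to see that the static language is compact.  The states of a
    canonical model are the assignments of truth values to static formulas all of
    whose finite parts are realized at a state of some Kripke model, and i
    relates two of them when they agree on all formulas K_i b.  States exist in
    sufficient supply because an ultrafilter of realized assignments converges
    pointwise, there being only finitely many truth values. *)
Require Import Defs.
From Stdlib Require Import RelationClasses.
From Stdlib Require List.
From mathcomp Require Import all_boot.
From mathcomp Require Import boolp classical_sets filter.

Set Implicit Arguments.
Unset Strict Implicit.
Unset Printing Implicit Defensive.

Local Open Scope classical_set_scope.

(** Turns an equation between infima into quantified bounds, with no case analysis on the value
    reached. *)
Lemma tle_eq (x y : tv) : (forall z, tle z x <-> tle z y) -> x = y.
Proof.
move=> h; have := (h x).1 (leqnn _); have := (h y).2 (leqnn _).
by case: x y {h} => [] [].
Qed.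

Lemma tle_tmin (z x y : tv) : tle z (tmin x y) = tle z x && tle z y.
Proof. by case: x y z => [] [] []. Qed.

Lemma tle_tinf (z : tv) (A : set tv) :
  tle z (tinf A) <-> forall y, A y -> tle z y.
Proof.
split=> [zA y Ay|]; last exact: tinf_glb.
exact: leq_trans zA (tinf_lb Ay).
Qed.

(** Attainment comes from the finiteness of [tv]; One is set aside because it is also the infimum of
    the empty set. *)
Lemma tinf_attained (A : set tv) : tinf A <> One -> A (tinf A).
Proof. by rewrite /tinf; do 2?case: asboolP. Qed.

(* All binary truth functions are primitive, so that the induction on static
   formulas has a single propositional case. *)
Inductive static (P N : Type) : Type :=
  | SVar (p : P)
  | SOp (f : tv -> tv -> tv) (a b : static P N)
  | SKnow (i : N) (a : static P N).
Arguments SVar {P N} p.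

Section Reduction.
Variables (P N : Type).

Fixpoint seval (a : static P N) (M : kripke P N) (s : M) : tv :=
  match a with
  | SVar p => val_at s p
  | SOp f b c => f (seval b s) (seval c s)
  | SKnow i b => tinf [set seval b t | t in [set t | acc i s t]]
  end.

Definition sguard (c a : static P N) : static P N :=
  SOp (fun x y => if designated x then y else One) c a.

Lemma tle_seval_know (M : kripke P N) (s : M) (i : N) (a : static P N) (z : tv) :
  tle z (seval (SKnow i a) s) <-> forall t, acc i s t -> tle z (seval a t).
Proof.
rewrite /= tle_tinf; split=> [h t st|h _ [t st <-]]; last exact: h.
by apply: h; exists t.
Qed.

Section Reduce.
Variables (E : finType) (F : Type) (U : action_model N E F).
Variable c : E -> static P N.

(** The preconditions arrive already translated, as [c], so that [translate] can recurse on them.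
    The fold is seeded with the conjunct of [e] itself, harmless since [indist] is reflexive. *)
Fixpoint reduce (a : static P N) (e : E) : static P N :=
  sguard (c e)
    match a with
    | SVar p => SVar p
    | SOp f b b' => SOp f (reduce b e) (reduce b' e)
    | SKnow i b =>
        foldr (fun f d => SOp tmin (SKnow i (reduce b f)) d)
          (SKnow i (reduce b e)) [seq f <- enum E | indist U i e f]
    end.

Lemma tle_seval_foldr (M : kripke P N) (s : M) (z : tv)
    (d : E -> static P N) (d0 : static P N) (r : seq E) :
  tle z (seval (foldr (fun f b => SOp tmin (d f) b) d0 r) s) <->
  (forall f, f \in r -> tle z (seval (d f) s)) /\ tle z (seval d0 s).
Proof.
elim: r => [|f r IH] /=; first by split=> [|[]].
rewrite tle_tmin; split=> [/andP[zf /IH[zr z0]]|[zr z0]].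
  by split=> // g; rewrite inE => /predU1P[->|/zr].
apply/andP; split; first by apply: zr; rewrite mem_head.
by apply/IH; split=> // g gr; apply: zr; rewrite inE gr orbT.
Qed.

(** In the K_i case, related pairs (t, f) with [f] not executable at [t] are absent from the update;
    there the guard gives [reduce a f] the value One, which does not lower the infimum. *)
Lemma seval_reduce (M : kripke P N) (exec : pred (M * E)) :
  (forall t f, exec (t, f) = designated (seval (c f) t)) ->
  forall (a : static P N) (s : M) (e : E),
  seval (reduce a e) s =
  if (insub (s, e) : option {x : M * E | exec x}) is Some s'
  then @seval a (update U exec) s' else One.
Proof.
move=> execE; elim=> [p|g a IHa b IHb|i a IHa] s e /=; rewrite -execE;
  case: insubP => [s' xs s'E|/negPf-> //]; rewrite xs.
- by rewrite s'E.
- have sE : insub (s, e) = Some s' by rewrite -s'E valK.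
  by rewrite IHa IHb sE.
have eqU := indist_equiv U i.
have ee : indist U i e e by have [] := eqU e e e.
apply: tle_eq => z; split=> [/tle_seval_foldr[zr _]|].
  apply/(@tle_seval_know (update U exec)) => t' [st ef]; rewrite s'E in st ef.
  have /tle_seval_know/(_ (val t').1 st) : tle z (seval (SKnow i (reduce a (val t').2)) s).
    by apply: zr; rewrite mem_filter mem_enum andbT.
  by rewrite IHa -surjective_pairing valK.
move=> /(@tle_seval_know (update U exec)) zU; apply/tle_seval_foldr.
have zf f : indist U i e f -> tle z (seval (SKnow i (reduce a f)) s).
  move=> ef; apply/tle_seval_know => t st; rewrite IHa.
  case: (insubP {x : M * E | exec x}) => [t' xt t'E|_]; last by case: (z).
  by apply: zU; split; rewrite s'E t'E.
by split=> [f|]; [rewrite mem_filter => /andP[/zf]|apply: zf].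
Qed.

End Reduce.

Fixpoint translate (a : formula P N) : static P N :=
  match a with
  | Var p => SVar p
  | Neg b => SOp (fun x _ => tneg x) (translate b) (translate b)
  | Incons b => SOp (fun x _ => tincons x) (translate b) (translate b)
  | And b c => SOp tmin (translate b) (translate c)
  | Know i b => SKnow i (translate b)
  | Act E U e b => reduce U (fun f => translate (pre U f)) (translate b) e
  end.

Lemma eval_translate : forall (a : formula P N) (M : kripke P N) (s : M),
  eval a s = seval (translate a) s.
Proof.
(* An explicit [fix] gives access to the preconditions, which are nested inside the record [U]. *)
fix IH 1; case=> [p|b|b|b c|i b|E U e b] M s /=.
- by [].
- by rewrite IH.
- by rewrite IH.
- by rewrite !IH.
- by congr tinf; apply: eq_imagel => t _; apply: IH.
rewrite (@seval_reduce _ _ _ _ _ (executable U)) => [|t f].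
  by case: insub => // s'; apply: IH.
by rewrite /executable /= IH.
Qed.

End Reduction.

Section Canonical.
Variables (P N : Type).
Notation assignment := (static P N -> tv).

Definition fin_realizable (v : assignment) : Prop :=
  forall r : seq (static P N), exists (M : kripke P N) (s : M),
    forall a, List.In a r -> seval a s = v a.

(* C a x says that x is an admissible value for a. *)
Lemma exists_fin_realizable (C : static P N -> tv -> Prop) :
  (forall r : seq (static P N), exists (M : kripke P N) (s : M),
     forall a, List.In a r -> C a (seval a s)) ->
  exists v : assignment, fin_realizable v /\ forall a, C a (v a).
Proof.
move=> finC.
pose realized (v : assignment) :=
  exists (M : kripke P N) (s : M), forall a, seval a s = v a.
pose base r : set assignment :=
  [set w | realized w /\ forall a, List.In a r -> C a (w a)].
(* The sets [base r] generate a filter, proper by [finC]. An ultrafilter above it selects one of the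
   three values for each formula; these values form [v]. *)
pose F : set_system assignment := [set B | exists r, base r `<=` B].
have FF : ProperFilter F.
  split=> [[r]|].
    have [M [s sC]] := finC r.
    by move=> /(_ (fun a => seval a s)); apply; split=> //; exists M, s.
  split=> [|A B [r rA] [q qB]|A B AB [r rA]]; first by exists nil.
    exists (r ++ q) => w [rw wC]; split; [apply: rA|apply: qB];
      by split=> // a ar; apply: wC; apply/List.in_app_iff; tauto.
  by exists r => w /rA /AB.
have [G [UG FG]] := ultraFilterLemma FF.
have lim a : exists x, G [set w | w a = x].
  have [G0|G0] := in_ultra_setVsetC [set w | w a = Zero] UG.
    by exists Zero.
  have [G1|G1] := in_ultra_setVsetC [set w | w a = Half] UG.
    by exists Half.
  exists One; apply: filterS (filterI G0 G1) => w /= [].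
  by case: (w a).
have [v Gv] := choice lim.
have Gr r : G [set w | forall a, List.In a r -> w a = v a].
  elim: r => [|a r IH]; first by apply: filterS filterT => w _ b [].
  by apply: filterS (filterI (Gv a) IH) => w [wa wr] b /= [<-|/wr].
exists v; split=> [r|a].
  have Greal : G realized by apply: FG; exists nil => w [].
  have [w [[M [s sw]] wr]] := filter_ex (filterI Greal (Gr r)).
  by exists M, s => a /wr <-.
have GC : G [set w | C a (w a)].
  by apply: FG; exists [:: a] => w [_]; apply; left.
by have [w [/= wC wa]] := filter_ex (filterI GC (Gv a)); rewrite -wa.
Qed.

Definition canonical_acc (i : N) (v w : {v | fin_realizable v}) : Prop :=
  forall a, sval v (SKnow i a) = sval w (SKnow i a).

Lemma canonical_acc_equiv i : Equivalence (canonical_acc i).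
Proof. by split=> [v a|v w vw a|u v w uv vw a] //; rewrite uv. Qed.

Definition canonical : kripke P N :=
  Kripke canonical_acc_equiv (fun v p => sval v (SVar p)).

Lemma seval_know_acc (M : kripke P N) (i : N) (a : static P N) (s t : M) :
  acc i s t -> seval (SKnow i a) s = seval (SKnow i a) t.
Proof.
have [_ sym trans] := acc_equiv M i => st /=; congr (tinf (_ @` _)).
by apply/predeqP => u; split; apply: trans => //; apply: sym.
Qed.

Lemma seval_canonical (a : static P N) (v : canonical) :
  seval a v = sval v a.
Proof.
elim: a v => [p|f a IHa b IHb|i a IHa] v //=.
  have [M [s sv]] := proj2_sig v [:: a; b; SOp f a b].
  by rewrite IHa IHb -!sv //=; tauto.
have le_know (w : canonical) : tle (sval w (SKnow i a)) (sval w a).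
  have [M [s sw]] := proj2_sig w [:: a; SKnow i a].
  rewrite -!sw /=; try tauto.
  by apply: tinf_lb; exists s => //; have [refl _ _] := acc_equiv M i; apply: refl.
apply: tle_eq => z; rewrite tle_tinf; split=> [zinf|zv _ [w /= vw <-]]; last first.
  by rewrite IHa; apply: leq_trans (le_know w); rewrite -(vw a).
have [v1|vn1] := pselect (sval v (SKnow i a) = One); first by rewrite v1; case: (z).
(* The first clause makes the new state i-related to [v]; the second makes it a witness that the
   infimum is no larger than the value of K_i a. *)
pose C b x := (forall c, b = SKnow i c -> x = sval v b) /\
              (b = a -> x = sval v (SKnow i a)).
have [r|w [rw wC]] := exists_fin_realizable (C := C).
  have [M [s sv]] := proj2_sig v (SKnow i a :: r).
  have sva : seval (SKnow i a) s = sval v (SKnow i a) by apply: sv; left.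
  (* The state [t] attaining the infimum at [s] meets both clauses, since related states give K_i
     formulas the same values. *)
  have [|t /= st ta] := @tinf_attained [set seval a t | t in [set t | acc i s t]].
    by rewrite -/(seval (SKnow i a) s) sva.
  exists M, t => b br; split=> [c bc|->]; last by rewrite ta.
  by rewrite -sv; [rewrite bc (seval_know_acc _ st)|right].
pose w' : canonical := exist _ w rw.
have <- : seval a w' = sval v (SKnow i a) by rewrite IHa; apply: (wC a).2.
by apply: zinf; exists w' => // b; rewrite /= ((wC _).1 b).
Qed.

End Canonical.

Theorem corollary43 (P : countType) (N : finType)
    (G : formula P N -> Prop) (a : formula P N) :
  entails G a ->
  exists G' : seq (formula P N),
    (forall g, List.In g G' -> G g) /\
    entails (fun g => List.In g G') a.
Proof.
move=> Ga; apply: contrapT => noG'.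
(* An assignment admissible for [C] is a canonical state that refutes [Ga]. *)
pose C b x := (forall g, G g -> translate g = b -> designated x) /\
              (translate a = b -> ~ designated x).
have [r|v [rv vC]] := exists_fin_realizable (C := C).
  (* One preimage in [G] for each translated formula in [r] is enough, because the value of a
     formula depends only on its translation. *)
  have [G' [G'G rG']] : exists G' : seq (formula P N),
      (forall g, List.In g G' -> G g) /\
      forall b g, List.In b r -> G g -> translate g = b ->
        exists2 g', List.In g' G' & translate g' = b.
    elim: r => [|b r [G' [G'G rG']]]; first by exists nil.
    have [[g Gg gb]|nob] := pselect (exists2 g, G g & translate g = b).
      exists (g :: G'); split=> [h /= [<- //|/G'G //]|b' h /= [<- _ _|b'r Gh hb']].
        by exists g => //; left.
      by have [g' ? ?] := rG' b' h b'r Gh hb'; exists g' => //; right.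
    exists G'; split=> // b' h /= [<- Gh hb|]; last exact: rG'.
    by case: nob; exists h.
  apply: contrapT => noM; apply: noG'; exists G'; split=> // M s sG'.
  apply: contrapT => sa; apply: noM; exists M, s => b br; split=> [g Gg gb|<-].
    by have [g' /sG' + <-] := rG' b g br Gg gb; rewrite eval_translate.
  by rewrite -eval_translate.
pose s : canonical P N := exist _ v rv.
have := Ga (canonical P N) s; rewrite eval_translate seval_canonical.
move=> sa; apply: ((vC (translate a)).2 erefl); apply: sa => g Gg.
by rewrite eval_translate seval_canonical; apply: (vC _).1 Gg erefl.
Qed.
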